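(* Let $\gamma\in(0,2)$, $\Sigma_+^*\in(-1,0)$, $\lambda^*\ge 1$, and put $A^*=1+\Sigma_+^*$, $N^*=\sqrt{-\Sigma_+^*(1+\Sigma_+^* )}$. Assume that there is a closed properly periodic orbit $c(\tau)$ of the reduced tilt system with these parameters (see context). Then either $$\langle x\rangle=-\frac{(3\gamma-4)-\Sigma_+^*}{(1+\Sigma_+^* )(3-2\gamma)},\qquad \langle\lambda_\Omega\rangle=-\frac{(1-2\Sigma_+^* )(5\gamma-6)}{3-2\gamma},$$ or $V=1$ along $c$ and $$\langle x\rangle=\frac{1+\Sigma_+^*}{3\Sigma_+^*},\qquad \langle\lambda_\Omega\rangle=\frac{(1-2\Sigma_+^* )(1+2\Sigma_+^* )}{\Sigma_+^*}.$$ Here $\langle\cdot\rangle$ denotes the average over one period along $c$.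
   Context: Reduced tilt system. The variables are $x=v_1$, $\rho=v_2^2+v_3^2$ and the angle $\theta$ (mod $2\pi$) defined for $\rho>0$ by $2v_2v_3=\rho\sin\theta$, $v_2^2-v_3^2=\rho\cos\theta$, where $(v_1,v_2,v_3)\in\mathbb{R}^3$ is the tilt velocity, considered up to the symmetry $(v_2,v_3)\mapsto(-v_2,-v_3)$. The state space is $\rho\ge 0$, $V^2:=x^2+\rho\le 1$ (with $V\ge0$); at $\rho=0$ the angle $\theta$ has no meaning (all points with $\rho=0$ and the same $x$ are identified). The parameters $\gamma,\Sigma_+^*,\lambda^*$, and hence $A^*=1+\Sigma_+^*$ and $N^*=\sqrt{-\Sigma_+^*(1+\Sigma_+^* )}$, are constants. The system is (prime $=d/d\tau$) $$x'=(T+2\Sigma_+^* )x-(A^*+\sqrt3N^*\cos\theta)\rho,$$ $$\rho'=2\left(T-\Sigma_+^*+A^*x-\alpha\cos\theta\right)\rho,$$ $$\theta'=2\alpha(\lambda^*+\sin\theta),$$ where $\alpha=\sqrt3(1-x)N^*$, $$T=\frac{\left[(3\gamma-4)-2(\gamma-1)A^*x\right](1-V^2)+(2-\gamma)V^2\mathcal{S}}{1-(\gamma-1)V^2},\qquad V^2\mathcal{S}=-2\Sigma_+^*x^2+\Sigma_+^*\rho+\sqrt3N^*\rho\cos\theta .$$ The quantity $\lambda_\Omega$ (the logarithmic growth rate $\Omega'/\Omega$ of the energy density, evaluated on the vacuum plane-wave background) is $$\lambda_\Omega=\frac{1}{1+(\gamma-1)V^2}\Big\{2q-(3\gamma-2)+2\gamma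 A^*x+\left[2q(\gamma-1)-(2-\gamma)-\gamma\mathcal{S}\right]V^2\Big\},\qquad q=-2\Sigma_+^*.$$ A properly periodic orbit is a periodic orbit which is not an equilibrium point. For a periodic orbit $c$ with period $T_n$, the average of a function $B$ is $\langle B\rangle=\frac1{T_n}\oint_c B\,d\tau=\frac{1}{T_n}\int_{\tau_0}^{\tau_0+T_n}B(c(\tau))\,d\tau$. *)

(* Defs.v *)
From Stdlib Require Import Reals ZArith.
From Coquelicot Require Import Coquelicot.
Open Scope R_scope.

(* [theta] is a real representative of an angle modulo [2 * PI]; it carries no
   information when [rho = 0].  Equality of points of the state space is
   therefore [same_point] below, not Leibniz equality. *)
Record state : Type := mkState { px : R; prho : R; ptheta : R }.

Definition same_point (p q : state) : Prop :=
  px p = px q /\ prho p = prho q /\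
  (0 < prho p -> exists k : Z, ptheta p = ptheta q + 2 * PI * IZR k).

Definition Vsq (p : state) : R := px p ^ 2 + prho p.
Definition V (p : state) : R := sqrt (Vsq p).

Definition in_state_space (p : state) : Prop := 0 <= prho p /\ Vsq p <= 1.

(* In all that follows [Sp] is Sigma_+^* and [lam] is lambda^*. *)

Definition Astar (Sp : R) : R := 1 + Sp.
Definition Nstar (Sp : R) : R := sqrt (- Sp * (1 + Sp)).

Definition alpha (Sp : R) (p : state) : R := sqrt 3 * (1 - px p) * Nstar Sp.

(* The product V^2 S.  Only this product is ever needed, and unlike S it is
   defined at V = 0. *)
Definition VsqS (Sp : R) (p : state) : R :=
  - 2 * Sp * px p ^ 2 + Sp * prho p
  + sqrt 3 * Nstar Sp * prho p * cos (ptheta p).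

(* The denominators here and in [lambda_Omega] are positive on the state space
   when 0 < gamma < 2. *)
Definition T (gamma Sp : R) (p : state) : R :=
  (((3 * gamma - 4) - 2 * (gamma - 1) * Astar Sp * px p) * (1 - Vsq p)
   + (2 - gamma) * VsqS Sp p)
  / (1 - (gamma - 1) * Vsq p).

Definition field_x (gamma Sp : R) (p : state) : R :=
  (T gamma Sp p + 2 * Sp) * px p
  - (Astar Sp + sqrt 3 * Nstar Sp * cos (ptheta p)) * prho p.

Definition field_rho (gamma Sp : R) (p : state) : R :=
  2 * (T gamma Sp p - Sp + Astar Sp * px p - alpha Sp p * cos (ptheta p))
  * prho p.

Definition field_theta (Sp lam : R) (p : state) : R :=
  2 * alpha Sp p * (lam + sin (ptheta p)).

(* The equation for the angle is imposed only where the angle has a meaning. *)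
Definition is_orbit (gamma Sp lam : R) (c : R -> state) : Prop :=
  forall tau : R,
    in_state_space (c tau) /\
    is_derive (fun t => px (c t)) tau (field_x gamma Sp (c tau)) /\
    is_derive (fun t => prho (c t)) tau (field_rho gamma Sp (c tau)) /\
    (0 < prho (c tau) ->
     is_derive (fun t => ptheta (c t)) tau (field_theta Sp lam (c tau))).

Definition equilibrium_point (gamma Sp lam : R) (p : state) : Prop :=
  field_x gamma Sp p = 0 /\ field_rho gamma Sp p = 0 /\
  (0 < prho p -> field_theta Sp lam p = 0).

Definition is_periodic_orbit (gamma Sp lam : R) (c : R -> state) (Tn : R)
  : Prop :=
  is_orbit gamma Sp lam c /\ 0 < Tn /\
  forall tau : R, same_point (c (tau + Tn)) (c tau).

Definition is_properly_periodic_orbit (gamma Sp lam : R) (c : R -> state)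
  (Tn : R) : Prop :=
  is_periodic_orbit gamma Sp lam c Tn /\
  ~ (forall tau : R, equilibrium_point gamma Sp lam (c tau)).

(* [m] is the average of [B] over one period of [c].  A relation rather than
   [/ Tn * RInt _ _ _], so that it also asserts integrability. *)
Definition is_average (c : R -> state) (Tn : R) (B : state -> R) (m : R)
  : Prop :=
  forall tau0 : R, exists I : R,
    is_RInt (fun tau => B (c tau)) tau0 (tau0 + Tn) I /\ m = / Tn * I.

Definition lambda_Omega (gamma Sp : R) (p : state) : R :=
  let q := - 2 * Sp in
  / (1 + (gamma - 1) * Vsq p)
  * (2 * q - (3 * gamma - 2) + 2 * gamma * Astar Sp * px p
     + (2 * q * (gamma - 1) - (2 - gamma)) * Vsq p - gamma * VsqS Sp p).

(* Main.v *)
(* A nowhere vanishing periodic solution of [y' = a y] forces the mean of [a]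
   over a period to be zero.  For the present system the functions [rho],
   [lam + sin theta], [1 - V^2] and [1 + (gamma - 1) V^2] all satisfy such
   equations, and [x - <x>] and [lambda_Omega - <lambda_Omega>] are linear
   combinations of the corresponding coefficients.  If [V = 1] at one point then
   [V = 1] along the whole orbit, and [1 - x] takes the place of [1 - V^2].  The
   axis [rho = 0] is invariant and carries a scalar autonomous equation, so a
   properly periodic orbit never meets it. *)
Require Import Defs.
From Stdlib Require Import Reals ZArith Lra Lia.
From Coquelicot Require Import Coquelicot.
Open Scope R_scope.

(** * Functions whose integral over every period vanishes *)

Definition zero_mean (P : R) (f : R -> R) : Prop :=
  forall t0 : R, is_RInt f t0 (t0 + P) 0.

Lemma zero_mean_ext (P : R) (f g : R -> R) :
  (forall t, f t = g t) -> zero_mean P f -> zero_mean P g.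
Proof.
  intros H Hf t0. apply is_RInt_ext with f; [|apply Hf].
  intros t _; apply H.
Qed.

(** With [b = 0] this also serves as scaling by [a]. *)
Lemma zero_mean_lin (P a b : R) (f g : R -> R) :
  zero_mean P f -> zero_mean P g -> zero_mean P (fun t => a * f t + b * g t).
Proof.
  intros Hf Hg t0.
  replace 0 with (plus (scal a 0) (scal b 0))
    by (unfold plus, scal; simpl; unfold mult; simpl; ring).
  apply @is_RInt_plus; apply @is_RInt_scal; [apply Hf | apply Hg].
Qed.

Lemma zero_mean_const (P k : R) : 0 < P -> zero_mean P (fun _ => k) -> k = 0.
Proof.
  intros HP H.
  pose proof (is_RInt_unique _ _ _ _ (H 0)) as E.
  rewrite RInt_const in E. unfold scal in E; simpl in E; unfold mult in E; simpl in E.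
  nra.
Qed.

Lemma is_average_of_zero_mean (c : R -> state) (P : R) (B : state -> R) (m : R) :
  0 < P -> zero_mean P (fun t => B (c t) - m) -> is_average c P B m.
Proof.
  intros HP H t0. exists (m * P). split; [|field; lra].
  replace (m * P) with (plus 0 (scal (t0 + P - t0) m))
    by (unfold plus, scal; simpl; unfold mult; simpl; ring).
  apply is_RInt_ext with (fun t => plus (B (c t) - m) m).
  - intros t _. unfold plus; simpl; ring.
  - apply @is_RInt_plus; [apply H | apply @is_RInt_const].
Qed.

(** * Scalar linear equations, Gronwall and monotonicity *)

(** Integrating factor: [y] times the exponential of minus the integral of [a] has zero
    derivative. *)
Lemma linear_ode_solution (y a : R -> R) :
  (forall t, is_derive y t (a t * y t)) -> (forall t, continuous a t) ->
  forall t0 t, y t = y t0 * exp (RInt a t0 t).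
Proof.
  intros Hy Ha t0 t.
  set (h := fun s => y s * exp (- RInt a t0 s)).
  assert (Hint : forall u v, ex_RInt a u v).
  { intros u v. apply @ex_RInt_continuous. intros; apply Ha. }
  assert (Hh : forall s, is_derive h s 0).
  { intros s. unfold h.
    assert (HI : is_derive (fun s => RInt a t0 s) s (a s)).
    { apply @is_derive_RInt with t0; [|apply Ha].
      apply filter_forall. intros z. apply @RInt_correct, Hint. }
    evar_last.
    - apply @is_derive_mult; [apply Hy | | intros; apply Rmult_comm].
      apply @is_derive_comp; [apply is_derive_exp|].
      apply @is_derive_opp. exact HI.
    - unfold plus, mult, scal, opp; simpl; unfold mult; simpl. ring. }
  assert (E : h t0 = h t).
  { destruct (Rtotal_order t0 t) as [L|[->|L]]; [|reflexivity|symmetry];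
      apply @eq_is_derive; auto. }
  unfold h in E. rewrite RInt_point in E. unfold zero in E; simpl in E.
  rewrite Ropp_0, exp_0, Rmult_1_r in E. rewrite E, Rmult_assoc, <- exp_plus.
  rewrite Rplus_opp_l, exp_0. ring.
Qed.

Lemma linear_ode_zero (y a : R -> R) :
  (forall t, is_derive y t (a t * y t)) -> (forall t, continuous a t) ->
  forall t0, y t0 = 0 -> forall t, y t = 0.
Proof.
  intros Hy Ha t0 H0 t.
  rewrite (linear_ode_solution y a Hy Ha t0 t), H0. ring.
Qed.

(** Over one period [y] is multiplied by [exp] of the integral of [a]; periodicity and [y <> 0] make
    this factor 1. *)
Lemma log_derivative_zero_mean (P : R) (y a : R -> R) :
  (forall t, is_derive y t (a t * y t)) -> (forall t, continuous a t) ->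
  (forall t, y (t + P) = y t) -> (forall t, y t <> 0) -> zero_mean P a.
Proof.
  intros Hy Ha Hper Hnz t0.
  assert (E : RInt a t0 (t0 + P) = 0).
  { pose proof (linear_ode_solution y a Hy Ha t0 (t0 + P)) as E.
    rewrite Hper in E. apply exp_inv. rewrite exp_0.
    apply Rmult_eq_reg_l with (y t0); [lra | apply Hnz]. }
  rewrite <- E. apply @RInt_correct, @ex_RInt_continuous.
  intros; apply Ha.
Qed.

Lemma nonneg_derive_le (f df : R -> R) :
  (forall t, is_derive f t (df t)) -> (forall t, 0 <= df t) ->
  forall s t, s <= t -> f s <= f t.
Proof.
  intros Hf Hdf s t Hst.
  destruct (MVT_gen f s t df) as [z [_ Hz]].
  - intros; apply Hf.
  - intros z _. apply continuity_pt_filterlim.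
    apply (ex_derive_continuous f z). exists (df z); apply Hf.
  - pose proof (Rmult_le_pos (df z) (t - s) (Hdf z)). lra.
Qed.

(* [a] is only bounded because the angle, and with it the logarithmic derivative
   of [rho], may jump where [rho] vanishes. *)
Lemma gronwall_zero (f a : R -> R) (K : R) :
  (forall t, is_derive f t (a t * f t)) -> (forall t, 0 <= f t) ->
  (forall t, Rabs (a t) <= K) ->
  forall t0, f t0 = 0 -> forall t, f t = 0.
Proof.
  intros Hf Hpos Ha t0 H0 t.
  assert (Hd : forall k s, is_derive (fun u => f u * exp (k * u)) s
                             ((a s + k) * (f s * exp (k * s)))).
  { intros k s. evar_last.
    - apply @is_derive_mult; [apply Hf | | intros; apply Rmult_comm].
      apply @is_derive_comp; [apply is_derive_exp|].
      apply is_derive_scal. apply @is_derive_id.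
    - unfold plus, mult, scal, one; simpl; unfold mult; simpl. ring. }
  assert (Hfe : forall k s, 0 <= f s * exp (k * s)).
  { intros k s. apply Rmult_le_pos; [apply Hpos | left; apply exp_pos]. }
  (* One weight for each direction of time: [f * exp (K t)] is nondecreasing and controls the past
     of [t0], [f * exp (- K t)] is nonincreasing and controls the future. *)
  assert (Hle : f t * exp (K * t) <= 0 \/ f t * exp (- K * t) <= 0).
  { destruct (Rle_dec t t0) as [L|L].
    - left. replace 0 with (f t0 * exp (K * t0)) by (rewrite H0; ring).
      apply (nonneg_derive_le (fun u => f u * exp (K * u)) _ (Hd K)); [|exact L].
      intros s. apply Rmult_le_pos; [|apply Hfe].
      specialize (Ha s). apply Rabs_le_between in Ha. lra.
    - right. apply Ropp_le_cancel. rewrite Ropp_0.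
      replace 0 with (- (f t0 * exp (- K * t0))) by (rewrite H0; ring).
      apply (nonneg_derive_le (fun u => - (f u * exp (- K * u)))
               (fun s => - ((a s + - K) * (f s * exp (- K * s))))).
      + intros s. apply @is_derive_opp. apply Hd.
      + intros s. rewrite <- Ropp_mult_distr_l_reverse.
        apply Rmult_le_pos; [|apply Hfe].
        specialize (Ha s). apply Rabs_le_between in Ha. lra.
      + lra. }
  specialize (Hpos t).
  destruct Hle as [H|H];
    [pose proof (exp_pos (K * t)) | pose proof (exp_pos (- K * t))]; nra.
Qed.

Lemma periodic_nonneg_derive_zero (P : R) (f df : R -> R) :
  0 < P -> (forall t, is_derive f t (df t)) -> (forall t, 0 <= df t) ->
  (forall t, f (t + P) = f t) -> forall t, df t = 0.
Proof.
  intros HP Hf Hdf Hper t.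
  pose proof (nonneg_derive_le f df Hf Hdf) as Hinc.
  assert (H0 : is_derive f t 0).
  (* Within distance [P] of [t] the function is constant: moving by a full period squeezes [f s]
     against [f t] from the other side. *)
  { apply is_derive_ext_loc with (fun _ => f t); [|apply @is_derive_const].
    exists (mkposreal P HP). intros s Hs.
    unfold ball in Hs; simpl in Hs; unfold AbsRing_ball in Hs; simpl in Hs.
    apply Rabs_lt_between in Hs. unfold minus, plus, opp in Hs; simpl in Hs.
    destruct (Rle_dec s t) as [L|L].
    - apply Rle_antisym; [|apply Hinc; lra].
      rewrite <- (Hper s). apply Hinc. lra.
    - apply Rle_antisym; [apply Hinc; lra|].
      rewrite <- (Hper t). apply Hinc. lra. }
  rewrite <- (is_derive_unique _ _ _ (Hf t)). apply is_derive_unique, H0.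
Qed.

(** * Periodicity of the sine, the denominators, and the evolution of [V^2] *)

Lemma sin_shift_2PI_Z (x : R) (k : Z) : sin (x + 2 * PI * IZR k) = sin x.
Proof.
  destruct (Z.le_gt_cases 0 k) as [L|L].
  - rewrite <- (Z2Nat.id k L), <- INR_IZR_INZ.
    rewrite <- (sin_period x (Z.to_nat k)). f_equal. ring.
  - rewrite <- (sin_period (x + 2 * PI * IZR k) (Z.to_nat (- k))).
    f_equal. rewrite INR_IZR_INZ, Z2Nat.id by lia. rewrite opp_IZR. ring.
Qed.

Lemma T_denominator_pos (gamma : R) (p : state) :
  0 < gamma < 2 -> in_state_space p -> 0 < 1 - (gamma - 1) * Vsq p.
Proof. intros Hg [Hr HV]. assert (0 <= Vsq p) by (unfold Vsq in *; nra). nra. Qed.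

Lemma lambda_denominator_pos (gamma : R) (p : state) :
  0 < gamma < 2 -> in_state_space p -> 0 < 1 + (gamma - 1) * Vsq p.
Proof. intros Hg [Hr HV]. assert (0 <= Vsq p) by (unfold Vsq in *; nra). nra. Qed.

(* [(V^2)' = 2 (1 - V^2) Vsq_rate]; eliminating the denominator of [T] in
   favour of this exact rate is what makes [T] linear in [x] on average. *)
Definition Vsq_rate (gamma Sp : R) (p : state) : R :=
  (((3 * gamma - 4) - 2 * (gamma - 1) * Astar Sp * px p) * Vsq p - VsqS Sp p)
  / (1 - (gamma - 1) * Vsq p).

Lemma T_eq_Vsq_rate (gamma Sp : R) (p : state) :
  1 - (gamma - 1) * Vsq p <> 0 ->
  T gamma Sp p =
  (3 * gamma - 4) - 2 * (gamma - 1) * Astar Sp * px p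
  - (2 - gamma) * Vsq_rate gamma Sp p.
Proof. intros H. unfold T, Vsq_rate. field. exact H. Qed.

(** The last term is the logarithmic derivative of [1 + (gamma - 1) V^2], so it averages out; the
    rest is affine in [x] and the rate. *)
Lemma lambda_Omega_eq_Vsq_rate (gamma Sp : R) (p : state) :
  1 - (gamma - 1) * Vsq p <> 0 -> 1 + (gamma - 1) * Vsq p <> 0 ->
  lambda_Omega gamma Sp p =
  - 4 * Sp - (3 * gamma - 2) + 2 * gamma * Astar Sp * px p
  + (2 - gamma) * Vsq_rate gamma Sp p
  + 2 * (gamma - 1) * (1 - Vsq p) * Vsq_rate gamma Sp p
    / (1 + (gamma - 1) * Vsq p).
Proof. intros H1 H2. unfold lambda_Omega, Vsq_rate. field. split; assumption. Qed.

(** In [2 x x' + rho'] the [Astar] terms and the terms in [x rho cos theta] cancel, leaving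
    [2 (T V^2 - V^2 S)]. Inserting the rate yields the factor [1 - V^2] because
    [(gamma - 1) + (2 - gamma) = 1]. *)
Lemma Vsq_derive (gamma Sp lam : R) (c : R -> state) :
  0 < gamma < 2 -> is_orbit gamma Sp lam c ->
  forall t, is_derive (fun s => Vsq (c s)) t
              (2 * (1 - Vsq (c t)) * Vsq_rate gamma Sp (c t)).
Proof.
  intros Hg Hc t. destruct (Hc t) as [HS [Hx [Hr _]]].
  pose proof (T_denominator_pos gamma _ Hg HS) as HD.
  unfold Vsq at 1. evar_last.
  - apply @is_derive_plus; [|exact Hr].
    apply is_derive_pow. exact Hx.
  - unfold field_x, field_rho. rewrite T_eq_Vsq_rate by lra.
    (* Solving the definition of the rate for [V^2 S] leaves a polynomial identity once the rate is
       abstracted as [e]. *)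
    assert (E : VsqS Sp (c t) =
              ((3 * gamma - 4) - 2 * (gamma - 1) * Astar Sp * px (c t)) * Vsq (c t)
              - (1 - (gamma - 1) * Vsq (c t)) * Vsq_rate gamma Sp (c t))
      by (unfold Vsq_rate; field; lra).
    set (e := Vsq_rate gamma Sp (c t)) in *.
    unfold plus; simpl. unfold VsqS, Vsq in *. unfold alpha, Astar in *.
    nra.
Qed.

(** * Bounds on the state space, and orbits on the axis [rho = 0] *)

Lemma state_space_x_bound (p : state) : in_state_space p -> -1 <= px p <= 1.
Proof. unfold in_state_space, Vsq. intros [Hr HV]. nra. Qed.

Lemma tilt_coefficient_nonneg (Sp : R) : 0 <= sqrt 3 * Nstar Sp.
Proof. apply Rmult_le_pos; apply sqrt_pos. Qed.

Lemma Rabs_mult_le (a b A B : R) :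
  Rabs a <= A -> Rabs b <= B -> Rabs (a * b) <= A * B.
Proof.
  intros Ha Hb. rewrite Rabs_mult.
  apply Rmult_le_compat; auto using Rabs_pos.
Qed.

Lemma T_bounded (gamma Sp : R) :
  0 < gamma < 2 -> -1 < Sp < 0 ->
  exists K, forall p, in_state_space p -> Rabs (T gamma Sp p) <= K.
Proof.
  intros Hg HSp.
  set (n := sqrt 3 * Nstar Sp).
  pose proof (tilt_coefficient_nonneg Sp) as Hn; fold n in Hn.
  (* Here 6 bounds the bracket affine in [x], 2 bounds [2 - gamma], and [3 + n] bounds [V^2 S]. The
     denominator is affine in [V^2] on [0, 1] with end values 1 and [2 - gamma], hence the
     minimum. *)
  exists ((6 + 2 * (3 + n)) * / Rmin 1 (2 - gamma)). intros p Hp.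
  pose proof (state_space_x_bound p Hp) as Hx.
  destruct Hp as [Hr HV].
  assert (HV0 : 0 <= Vsq p) by (unfold Vsq in *; nra).
  assert (Hr1 : prho p <= 1) by (unfold Vsq in HV; nra).
  assert (Hx2 : 0 <= px p ^ 2 <= 1) by (unfold Vsq in HV; nra).
  assert (HD : Rmin 1 (2 - gamma) <= 1 - (gamma - 1) * Vsq p).
  { unfold Rmin. destruct (Rle_dec 1 (2 - gamma)); nra. }
  assert (Hm : 0 < Rmin 1 (2 - gamma)) by (apply Rmin_glb_lt; lra).
  assert (HQ : Rabs (VsqS Sp p) <= 3 + n).
  { unfold VsqS. fold n.
    assert (H1 : Rabs (n * prho p * cos (ptheta p)) <= n * 1 * 1).
    { apply Rabs_mult_le; [apply Rabs_mult_le|]; apply Rabs_le;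
        try split; try lra; apply COS_bound. }
    apply Rabs_le_between in H1. apply Rabs_le. nra. }
  assert (HB : Rabs ((3 * gamma - 4) - 2 * (gamma - 1) * Astar Sp * px p) <= 6).
  { assert (H1 : Rabs ((gamma - 1) * Astar Sp * px p) <= 1 * 1 * 1).
    { unfold Astar.
      apply Rabs_mult_le; [apply Rabs_mult_le|]; apply Rabs_le; lra. }
    apply Rabs_le_between in H1. apply Rabs_le. lra. }
  unfold T, Rdiv. apply Rabs_mult_le.
  - eapply Rle_trans; [apply Rabs_triang|]. apply Rplus_le_compat.
    + replace 6 with (6 * 1) by ring. apply Rabs_mult_le; [exact HB|].
      apply Rabs_le; lra.
    + apply Rabs_mult_le; [apply Rabs_le; lra | exact HQ].
  - rewrite Rabs_pos_eq.
    + apply Rinv_le_contravar; assumption.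
    + left. apply Rinv_0_lt_compat. lra.
Qed.

Lemma rho_zero_everywhere (gamma Sp lam : R) (c : R -> state) :
  0 < gamma < 2 -> -1 < Sp < 0 -> is_orbit gamma Sp lam c ->
  forall t0, prho (c t0) = 0 -> forall t, prho (c t) = 0.
Proof.
  intros Hg HSp Hc.
  destruct (T_bounded gamma Sp Hg HSp) as [K HK].
  apply (gronwall_zero _ (fun t =>
      2 * (T gamma Sp (c t) - Sp + Astar Sp * px (c t)
           - alpha Sp (c t) * cos (ptheta (c t))))
    (* [K] bounds [T], 2 bounds the terms in [Sp] and [Astar * x], and the last summand uses
       [1 - x <= 2]. *)
    (2 * (K + 2 + 2 * (sqrt 3 * Nstar Sp)))).
  - intros t. destruct (Hc t) as [_ [_ [Hr _]]]. exact Hr.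
  - intros t. apply (Hc t).
  - intros t. destruct (Hc t) as [HS _].
    specialize (HK _ HS). apply state_space_x_bound in HS.
    pose proof (tilt_coefficient_nonneg Sp) as Hn.
    assert (H1 : Rabs (sqrt 3 * Nstar Sp * (1 - px (c t)) * cos (ptheta (c t)))
                 <= sqrt 3 * Nstar Sp * 2 * 1).
    { apply Rabs_mult_le; [apply Rabs_mult_le|]; apply Rabs_le;
        try split; try lra; apply COS_bound. }
    apply Rabs_le_between in HK. apply Rabs_le_between in H1.
    unfold alpha, Astar. apply Rabs_le. nra.
Qed.

(* On the axis [rho = 0] the system is the scalar equation [x' = p(x) / D(x)]
   with [D > 0] and [p] a cubic; an antiderivative of [p] is a strict Lyapunov
   function. *)
Lemma rho_zero_equilibrium (gamma Sp lam : R) (c : R -> state) (P : R) :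
  0 < gamma < 2 -> is_periodic_orbit gamma Sp lam c P ->
  (forall t, prho (c t) = 0) ->
  forall t, equilibrium_point gamma Sp lam (c t).
Proof.
  intros Hg [Hc [HP Hper]] Hrho.
  set (D := fun t => 1 - (gamma - 1) * px (c t) ^ 2).
  assert (HD : forall t, 0 < D t).
  { intros t. pose proof (T_denominator_pos gamma _ Hg (proj1 (Hc t))) as H.
    unfold Vsq in H. rewrite Hrho, Rplus_0_r in H. exact H. }
  set (a1 := 3 * gamma - 4 + 2 * Sp).
  set (a2 := - 2 * (gamma - 1) * Astar Sp).
  set (a3 := - (3 * gamma - 4) - 2 * Sp).
  (* Since [a3 = - a1], this is [x (1 - x^2) (a1 + a2 x)], in general of degree four. *)
  set (pol := fun x : R => a1 * x + a2 * x ^ 2 + a3 * x ^ 3 - a2 * x ^ 4).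
  assert (Hfx : forall t, field_x gamma Sp (c t) = pol (px (c t)) / D t).
  { intros t. unfold field_x, T, VsqS, Vsq. rewrite Hrho, Rplus_0_r.
    specialize (HD t). unfold pol, D, a1, a2, a3 in *. field. lra. }
  set (F := fun x : R =>
    a1 * x ^ 2 / 2 + a2 * x ^ 3 / 3 + a3 * x ^ 4 / 4 - a2 * x ^ 5 / 5).
  (* The derivative of [F(x)] along the orbit is [pol(x) * x' = pol(x)^2 / D >= 0], and [F(x)] is
     periodic. *)
  assert (Hz : forall t, pol (px (c t)) ^ 2 / D t = 0).
  { apply (periodic_nonneg_derive_zero P (fun t => F (px (c t)))); [exact HP| | |].
    - intros t. evar_last.
      + apply @is_derive_comp; [|apply (Hc t)].
        instantiate (1 := pol (px (c t))).
        unfold F. auto_derive; [exact I|]. unfold pol. field.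
      + rewrite Hfx. unfold scal; simpl; unfold mult; simpl.
        specialize (HD t). field. lra.
    - intros t. apply Rmult_le_pos; [apply pow2_ge_0|].
      left. apply Rinv_0_lt_compat, HD.
    - intros t. destruct (Hper t) as [-> _]. reflexivity. }
  intros t. split; [|split].
  - rewrite Hfx. specialize (Hz t). specialize (HD t).
    assert (H : pol (px (c t)) ^ 2 = 0).
    { apply Rmult_eq_reg_r with (/ D t);
        [|apply Rinv_neq_0_compat; lra].
      rewrite Rmult_0_l. exact Hz. }
    rewrite <- Rsqr_pow2 in H. apply Rsqr_0_uniq in H.
    rewrite H. unfold Rdiv. ring.
  - unfold field_rho. rewrite Hrho. ring.
  - rewrite Hrho. lra.
Qed.

(** * Differentiability along orbits off the axis, where the angle is differentiable too *)

Lemma coordinates_ex_derive (gamma Sp lam : R) (c : R -> state) :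
  is_orbit gamma Sp lam c -> (forall t, 0 < prho (c t)) ->
  forall t, ex_derive (fun s => px (c s)) t /\ ex_derive (fun s => prho (c s)) t
            /\ ex_derive (fun s => ptheta (c s)) t.
Proof.
  intros Hc Hrho t. destruct (Hc t) as [_ [Hx [Hr Hth]]].
  specialize (Hth (Hrho t)).
  repeat split; eexists; eassumption.
Qed.

(** Taking three separate scalar functions suits [auto_derive]; as [Vsq_rate] reads only the
    projections, the result transfers to an orbit by conversion. *)
Lemma Vsq_rate_ex_derive (gamma Sp : R) (x r th : R -> R) (t : R) :
  ex_derive x t -> ex_derive r t -> ex_derive th t ->
  1 - (gamma - 1) * (x t ^ 2 + r t) <> 0 ->
  ex_derive (fun s => Vsq_rate gamma Sp (mkState (x s) (r s) (th s))) t.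
Proof.
  intros Hx Hr Hth HD. unfold Vsq_rate, Vsq, VsqS; cbn [px prho ptheta].
  auto_derive. repeat split; auto.
Qed.

Lemma alpha_cos_ex_derive (Sp : R) (x r th : R -> R) (t : R) :
  ex_derive x t -> ex_derive th t ->
  ex_derive (fun s => alpha Sp (mkState (x s) (r s) (th s)) * cos (th s)) t.
Proof.
  intros Hx Hth. unfold alpha; cbn [px prho ptheta]. auto_derive. auto.
Qed.

Lemma Vsq_rate_orbit_ex_derive (gamma Sp lam : R) (c : R -> state) :
  0 < gamma < 2 -> is_orbit gamma Sp lam c -> (forall t, 0 < prho (c t)) ->
  forall t, ex_derive (fun s => Vsq_rate gamma Sp (c s)) t.
Proof.
  intros Hg Hc Hrho t.
  destruct (coordinates_ex_derive gamma Sp lam c Hc Hrho t) as [Hx [Hr Hth]].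
  apply (Vsq_rate_ex_derive gamma Sp (fun s => px (c s)) (fun s => prho (c s))
           (fun s => ptheta (c s)) t Hx Hr Hth).
  pose proof (T_denominator_pos gamma _ Hg (proj1 (Hc t))) as H.
  unfold Vsq in H. lra.
Qed.

Lemma alpha_cos_orbit_ex_derive (gamma Sp lam : R) (c : R -> state) :
  is_orbit gamma Sp lam c -> (forall t, 0 < prho (c t)) ->
  forall t, ex_derive (fun s => alpha Sp (c s) * cos (ptheta (c s))) t.
Proof.
  intros Hc Hrho t.
  destruct (coordinates_ex_derive gamma Sp lam c Hc Hrho t) as [Hx [_ Hth]].
  exact (alpha_cos_ex_derive Sp (fun s => px (c s)) (fun s => prho (c s))
           (fun s => ptheta (c s)) t Hx Hth).
Qed.

(** * Logarithmic derivatives along a periodic orbit *)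

(* [(lam + sin theta)' = 2 alpha cos theta (lam + sin theta)].  When [lam = 1]
   this factor may vanish identically, but then [cos theta] does too. *)
Lemma alpha_cos_zero_mean (gamma Sp lam : R) (c : R -> state) (P : R) :
  1 <= lam -> is_periodic_orbit gamma Sp lam c P ->
  (forall t, 0 < prho (c t)) ->
  zero_mean P (fun t => alpha Sp (c t) * cos (ptheta (c t))).
Proof.
  intros Hlam [Hc [HP Hper]] Hrho.
  set (a := fun t => alpha Sp (c t) * cos (ptheta (c t))).
  set (u := fun t => lam + sin (ptheta (c t))).
  assert (Hu : forall t, is_derive u t (2 * a t * u t)).
  { intros t. destruct (Hc t) as [_ [_ [_ Hth]]]. specialize (Hth (Hrho t)).
    unfold u, a. evar_last.
    - apply @is_derive_plus; [apply @is_derive_const|].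
      apply @is_derive_comp; [apply is_derive_sin | exact Hth].
    - unfold field_theta, plus, zero, scal; simpl; unfold mult; simpl. ring. }
  assert (Ha : forall t, continuous (fun s => 2 * a s) t).
  { intros t. apply (ex_derive_continuous (fun s => 2 * a s) t).
    apply ex_derive_scal.
    exact (alpha_cos_orbit_ex_derive gamma Sp lam c Hc Hrho t). }
  destruct (Req_dec (u 0) 0) as [H0|H0].
  - intros t0. apply is_RInt_ext with (fun _ => 0).
    + intros t _.
      pose proof (linear_ode_zero u _ Hu Ha 0 H0 t) as Hut. unfold u in Hut.
      pose proof (SIN_bound (ptheta (c t))).
      pose proof (sin2_cos2 (ptheta (c t))) as E. unfold Rsqr in E.
      assert (Hs : sin (ptheta (c t)) = -1) by lra.
      rewrite Hs in E.
      assert (Hcos : cos (ptheta (c t)) = 0) by nra.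
      unfold a. rewrite Hcos. symmetry. apply Rmult_0_r.
    + evar_last; [apply @is_RInt_const|].
      unfold scal; simpl; unfold mult; simpl; ring.
  - assert (Hz : zero_mean P (fun t => 2 * a t)).
    { apply (log_derivative_zero_mean P u _ Hu Ha).
      - intros t. destruct (Hper t) as [_ [Hr Hth]]. unfold u. f_equal.
        destruct Hth as [k Hk]; [apply Hrho|].
        rewrite Hk. apply sin_shift_2PI_Z.
      - intros t Ht. apply H0, (linear_ode_zero u _ Hu Ha t Ht 0). }
    apply zero_mean_ext with (fun t => / 2 * (2 * a t) + 0 * (2 * a t)).
    + intros t. unfold a. field.
    + apply zero_mean_lin; exact Hz.
Qed.

(** Half the logarithmic derivative of [rho], with its [alpha cos theta] part removed by
    [alpha_cos_zero_mean]. *)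
Lemma T_drift_zero_mean (gamma Sp lam : R) (c : R -> state) (P : R) :
  0 < gamma < 2 -> 1 <= lam -> is_periodic_orbit gamma Sp lam c P ->
  (forall t, 0 < prho (c t)) ->
  zero_mean P (fun t => T gamma Sp (c t) - Sp + Astar Sp * px (c t)).
Proof.
  intros Hg Hlam Hpo Hrho.
  pose proof (alpha_cos_zero_mean gamma Sp lam c P Hlam Hpo Hrho) as Hz.
  destruct Hpo as [Hc [HP Hper]].
  set (a := fun t => 2 * (T gamma Sp (c t) - Sp + Astar Sp * px (c t)
                          - alpha Sp (c t) * cos (ptheta (c t)))).
  assert (Hrz : zero_mean P a).
  { apply (log_derivative_zero_mean P (fun t => prho (c t))).
    - intros t. apply (Hc t).
    - intros t. apply (ex_derive_continuous a t).
      (* Continuity of the coefficient comes from differentiability, with [T] expressed through the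
         rate already known to be differentiable. *)
      apply ex_derive_ext with (fun s =>
        2 * (3 * gamma - 4 - 2 * (gamma - 1) * Astar Sp * px (c s)
             - (2 - gamma) * Vsq_rate gamma Sp (c s) - Sp + Astar Sp * px (c s)
             - alpha Sp (c s) * cos (ptheta (c s)))).
      + intros s. unfold a. rewrite T_eq_Vsq_rate; [reflexivity|].
        apply Rgt_not_eq, T_denominator_pos; [exact Hg | apply (Hc s)].
      + pose proof (alpha_cos_orbit_ex_derive gamma Sp lam c Hc Hrho t) as H1.
        pose proof (Vsq_rate_orbit_ex_derive gamma Sp lam c Hg Hc Hrho t) as H2.
        destruct (coordinates_ex_derive gamma Sp lam c Hc Hrho t) as [H3 _].
        assert (G : forall f g h : R -> R,
          ex_derive f t -> ex_derive g t -> ex_derive h t ->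
          ex_derive (fun s =>
            2 * (3 * gamma - 4 - 2 * (gamma - 1) * Astar Sp * h s
                 - (2 - gamma) * g s - Sp + Astar Sp * h s - f s)) t)
          by (intros; auto_derive; auto).
        exact (G _ _ _ H1 H2 H3).
    - intros t. apply (Hper t).
    - intros t. apply Rgt_not_eq, Hrho. }
  apply zero_mean_ext with
    (fun t => / 2 * a t + 1 * (alpha Sp (c t) * cos (ptheta (c t)))).
  - intros t. unfold a. field.
  - apply zero_mean_lin; assumption.
Qed.

Lemma Vsq_rate_zero_mean (gamma Sp lam : R) (c : R -> state) (P : R) :
  0 < gamma < 2 -> is_periodic_orbit gamma Sp lam c P ->
  (forall t, 0 < prho (c t)) -> (forall t, Vsq (c t) <> 1) ->
  zero_mean P (fun t => Vsq_rate gamma Sp (c t)).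
Proof.
  intros Hg [Hc [HP Hper]] Hrho HV.
  assert (Hz : zero_mean P (fun t => - 2 * Vsq_rate gamma Sp (c t))).
  { apply (log_derivative_zero_mean P (fun t => 1 - Vsq (c t))).
    - intros t. evar_last.
      + apply @is_derive_minus; [apply @is_derive_const|].
        exact (Vsq_derive gamma Sp lam c Hg Hc t).
      + unfold minus, plus, opp, zero; simpl. ring.
    - intros t. apply (ex_derive_continuous (fun s => - 2 * Vsq_rate gamma Sp (c s)) t).
      apply ex_derive_scal.
      exact (Vsq_rate_orbit_ex_derive gamma Sp lam c Hg Hc Hrho t).
    - intros t. destruct (Hper t) as [Hx [Hr _]]. unfold Vsq. rewrite Hx, Hr.
      reflexivity.
    - intros t Ht. apply (HV t). lra. }
  apply zero_mean_ext with
    (fun t => - / 2 * (- 2 * Vsq_rate gamma Sp (c t))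
              + 0 * (- 2 * Vsq_rate gamma Sp (c t))).
  - intros t. field.
  - apply zero_mean_lin; exact Hz.
Qed.

(** The denominator of [lambda_Omega] is positive on the whole state space, so its logarithmic
    derivative exists whether or not [V = 1]. *)
Lemma lambda_denominator_zero_mean (gamma Sp lam : R) (c : R -> state) (P : R) :
  0 < gamma < 2 -> is_periodic_orbit gamma Sp lam c P ->
  (forall t, 0 < prho (c t)) ->
  zero_mean P (fun t => 2 * (gamma - 1) * (1 - Vsq (c t))
     * Vsq_rate gamma Sp (c t) / (1 + (gamma - 1) * Vsq (c t))).
Proof.
  intros Hg [Hc [HP Hper]] Hrho.
  assert (HD : forall t, 0 < 1 + (gamma - 1) * Vsq (c t)).
  { intros t. apply lambda_denominator_pos; [exact Hg | apply (Hc t)]. }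
  apply (log_derivative_zero_mean P (fun t => 1 + (gamma - 1) * Vsq (c t))).
  - intros t. evar_last.
    + apply @is_derive_plus; [apply @is_derive_const|].
      apply is_derive_scal. exact (Vsq_derive gamma Sp lam c Hg Hc t).
    + specialize (HD t). unfold plus, zero; simpl. field. lra.
  - intros t.
    pose proof (Vsq_rate_orbit_ex_derive gamma Sp lam c Hg Hc Hrho t) as H2.
    assert (H3 : ex_derive (fun s => Vsq (c s)) t)
      by (eexists; exact (Vsq_derive gamma Sp lam c Hg Hc t)).
    assert (G : forall f g : R -> R, ex_derive f t -> ex_derive g t ->
      1 + (gamma - 1) * f t <> 0 ->
      ex_derive (fun s =>
        2 * (gamma - 1) * (1 - f s) * g s / (1 + (gamma - 1) * f s)) t)
      by (intros; auto_derive; auto).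
    exact (ex_derive_continuous (V := R_NormedModule) _ t
             (G _ _ H3 H2 (Rgt_not_eq _ _ (HD t)))).
  - intros t. destruct (Hper t) as [Hx [Hr _]]. unfold Vsq. rewrite Hx, Hr.
    reflexivity.
  - intros t. apply Rgt_not_eq, HD.
Qed.

(** [1 - V^2] solves a homogeneous linear equation with continuous coefficient, so one zero forces
    it to vanish identically. *)
Lemma Vsq_one_everywhere (gamma Sp lam : R) (c : R -> state) :
  0 < gamma < 2 -> is_orbit gamma Sp lam c -> (forall t, 0 < prho (c t)) ->
  forall t0, Vsq (c t0) = 1 -> forall t, Vsq (c t) = 1.
Proof.
  intros Hg Hc Hrho t0 H0 t.
  cut (1 - Vsq (c t) = 0); [lra|].
  apply (linear_ode_zero (fun s => 1 - Vsq (c s))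
           (fun s => - 2 * Vsq_rate gamma Sp (c s))) with t0; [| |lra].
  - intros s. evar_last.
    + apply @is_derive_minus; [apply @is_derive_const|].
      exact (Vsq_derive gamma Sp lam c Hg Hc s).
    + unfold minus, plus, opp, zero; simpl. ring.
  - intros s. apply (ex_derive_continuous (fun s => - 2 * Vsq_rate gamma Sp (c s)) s).
    apply ex_derive_scal.
    exact (Vsq_rate_orbit_ex_derive gamma Sp lam c Hg Hc Hrho s).
Qed.

(* At [V = 1] one has [T = V^2 S] and [rho = 1 - x^2], so that [x] obeys a
   closed equation with factors [1 - x] and [1 + x]. *)
Lemma extreme_drift_zero_mean (gamma Sp lam : R) (c : R -> state) (P : R) :
  0 < gamma < 2 -> 1 <= lam -> is_periodic_orbit gamma Sp lam c P ->
  (forall t, 0 < prho (c t)) -> (forall t, Vsq (c t) = 1) ->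
  zero_mean P (fun t => 3 * Sp * px (c t) - Astar Sp).
Proof.
  intros Hg Hlam Hpo Hrho HV.
  pose proof (T_drift_zero_mean gamma Sp lam c P Hg Hlam Hpo Hrho) as HTz.
  destruct Hpo as [Hc [HP Hper]].
  (* This is the logarithmic derivative of [1 - x], which is nonzero because [rho = 1 - x^2 > 0]. *)
  set (a := fun t => - (1 + px (c t)) *
    (3 * Sp * px (c t) - Astar Sp - alpha Sp (c t) * cos (ptheta (c t)))).
  assert (HT : forall t, T gamma Sp (c t) = VsqS Sp (c t)).
  { intros t. unfold T. rewrite HV. field. lra. }
  assert (Hr : forall t, prho (c t) = 1 - px (c t) ^ 2).
  { intros t. specialize (HV t). unfold Vsq in HV. lra. }
  assert (Haz : zero_mean P a).
  { apply (log_derivative_zero_mean P (fun t => 1 - px (c t))).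
    - intros t. evar_last.
      + apply @is_derive_minus; [apply @is_derive_const | apply (Hc t)].
      + unfold minus, plus, opp, zero; simpl.
        unfold field_x, a. rewrite HT. unfold VsqS. rewrite Hr.
        unfold alpha, Astar. ring.
    - intros t. apply (ex_derive_continuous a t).
      pose proof (alpha_cos_orbit_ex_derive gamma Sp lam c Hc Hrho t) as H1.
      destruct (coordinates_ex_derive gamma Sp lam c Hc Hrho t) as [H2 _].
      assert (G : forall f g : R -> R, ex_derive f t -> ex_derive g t ->
        ex_derive (fun s => - (1 + g s) * (3 * Sp * g s - Astar Sp - f s)) t)
        by (intros; auto_derive; auto).
      exact (G _ _ H1 H2).
    - intros t. destruct (Hper t) as [-> _]. reflexivity.
    - intros t Ht. specialize (Hrho t). rewrite Hr in Hrho. nra. }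
  (* In this combination the terms in [x^2] and in [cos theta] cancel. *)
  apply zero_mean_ext with (fun t =>
    -1 * a t + 1 * (T gamma Sp (c t) - Sp + Astar Sp * px (c t))).
  - intros t. unfold a. rewrite HT. unfold VsqS. rewrite Hr.
    unfold alpha, Astar. ring.
  - apply zero_mean_lin; assumption.
Qed.

(* The first alternative includes [3 - 2 * gamma <> 0], so that at
   gamma = 3/2, where its right-hand sides are undefined, it is false. *)
Theorem theorem4p2 (gamma Sp lam : R)
  (hgamma : 0 < gamma < 2) (hSp : -1 < Sp < 0) (hlam : 1 <= lam)
  (c : R -> state) (Tn : R)
  (hc : is_properly_periodic_orbit gamma Sp lam c Tn) :
  (3 - 2 * gamma <> 0 /\
   is_average c Tn px
     (- (((3 * gamma - 4) - Sp) / ((1 + Sp) * (3 - 2 * gamma)))) /\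
   is_average c Tn (lambda_Omega gamma Sp)
     (- ((1 - 2 * Sp) * (5 * gamma - 6) / (3 - 2 * gamma))))
  \/
  ((forall tau : R, V (c tau) = 1) /\
   is_average c Tn px ((1 + Sp) / (3 * Sp)) /\
   is_average c Tn (lambda_Omega gamma Sp)
     ((1 - 2 * Sp) * (1 + 2 * Sp) / Sp)).
Proof.
  destruct hc as [Hpo Hne].
  pose proof Hpo as [Hc [HP _]].
  assert (Hrho : forall t, 0 < prho (c t)).
  { intros t. destruct (Hc t) as [[[H|H] _] _]; [exact H|].
    exfalso. apply Hne. apply (rho_zero_equilibrium gamma Sp lam c Tn hgamma Hpo).
    apply (rho_zero_everywhere gamma Sp lam c hgamma hSp Hc t). auto. }
  pose proof (T_drift_zero_mean gamma Sp lam c Tn hgamma hlam Hpo Hrho) as HT.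
  assert (HD : forall t, 1 - (gamma - 1) * Vsq (c t) <> 0).
  { intros t. apply Rgt_not_eq, T_denominator_pos; [exact hgamma | apply (Hc t)]. }
  assert (HL : forall t, 1 + (gamma - 1) * Vsq (c t) <> 0).
  { intros t. apply Rgt_not_eq, lambda_denominator_pos;
      [exact hgamma | apply (Hc t)]. }
  destruct (Req_dec (Vsq (c 0)) 1) as [H1|H1].
  - right.
    pose proof (Vsq_one_everywhere gamma Sp lam c hgamma Hc Hrho 0 H1) as HV.
    pose proof (extreme_drift_zero_mean gamma Sp lam c Tn hgamma hlam Hpo Hrho HV)
      as Hx.
    split; [|split].
    + intros t. unfold V. rewrite HV. apply sqrt_1.
    + apply is_average_of_zero_mean; [exact HP|].
      eapply zero_mean_ext; [|exact (zero_mean_lin _ (/ (3 * Sp)) 0 _ _ Hx Hx)].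
      intros t. cbv beta. unfold Astar. field. lra.
    + apply is_average_of_zero_mean; [exact HP|].
      eapply zero_mean_ext;
        (* At [V = 1], [lambda_Omega = - 4 Sp - 2 + 2 Astar x - T]. Coefficient -1 removes [T] and
           leaves [3 Astar x] plus a constant, which fixes the coefficient of [3 Sp x - Astar]. *)
        [|exact (zero_mean_lin _ (-1) ((1 + Sp) / Sp) _ _ HT Hx)].
      intros t. cbv beta. unfold T, lambda_Omega, Astar. rewrite HV.
      field. lra.
  - left.
    assert (HV : forall t, Vsq (c t) <> 1).
    { intros t Ht. apply H1.
      exact (Vsq_one_everywhere gamma Sp lam c hgamma Hc Hrho t Ht 0). }
    pose proof (Vsq_rate_zero_mean gamma Sp lam c Tn hgamma Hpo Hrho HV) as HE.
    pose proof (lambda_denominator_zero_mean gamma Sp lam c Tn hgamma Hpo Hrho)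
      as HF.
    (* Adding [2 - gamma] times the rate to the drift of [rho] cancels the rate inside [T]. *)
    assert (Hx : zero_mean Tn (fun t =>
      (3 * gamma - 4 - Sp) + (3 - 2 * gamma) * (1 + Sp) * px (c t))).
    { eapply zero_mean_ext; [|exact (zero_mean_lin _ 1 (2 - gamma) _ _ HT HE)].
      intros t. cbv beta. rewrite T_eq_Vsq_rate by apply HD. unfold Astar. ring. }
    (* At [gamma = 3/2] the relation [Hx] would give the positive constant [1/2 - Sp] zero mean. *)
    assert (Hg : 3 - 2 * gamma <> 0).
    { intros Hg.
      assert (H : 3 * gamma - 4 - Sp = 0); [|lra].
      apply (zero_mean_const Tn _ HP).
      eapply zero_mean_ext; [|exact Hx]. intros t. cbv beta. rewrite Hg. ring. }
    split; [exact Hg | split].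
    + apply is_average_of_zero_mean; [exact HP|].
      eapply zero_mean_ext;
        [|exact (zero_mean_lin _ (/ ((1 + Sp) * (3 - 2 * gamma))) 0 _ _ Hx Hx)].
      intros t. cbv beta. field. lra.
    + apply is_average_of_zero_mean; [exact HP|].
      eapply zero_mean_ext;
        (* The first coefficient turns [(3 - 2 gamma) Astar x] into [2 gamma Astar x]; [HE] and [HF]
           account for the two rate terms of [lambda_Omega_eq_Vsq_rate]. *)
        [|exact (zero_mean_lin _ 1 1 _ _
            (zero_mean_lin _ (2 * gamma / (3 - 2 * gamma)) (2 - gamma) _ _ Hx HE)
            HF)].
      intros t. cbv beta.
      rewrite lambda_Omega_eq_Vsq_rate by auto. unfold Astar. field. auto.
Qed.
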